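(* Let $G$ be a discrete group acting on a smooth manifold $X$ by a smooth and discrete action. Then $X/G$ has the structure of a smooth manifold locally diffeomorphic to $X$, and the translation map $\tau\colon X\times_G X\to G$ is continuous.
   Context: Smooth manifolds are Hausdorff and second countable. The (right) action of a discrete group $G$ on a smooth manifold $X$ is a covering-space action if every $x\in X$ has a neighborhood $U$ with $U\cap U\cdot g=\emptyset$ for all $g\ne e$ (in particular it is free). It is discrete if it is a covering-space action and, for any two points $x,y\in X$ with different orbits, there are neighborhoods $U$ of $x$ and $V$ of $y$ whose orbits $U\cdot G$, $V\cdot G$ are disjoint. $X/G$ is the orbit space with the quotient topology. $X\times_G X=\{(x,y)\in X\times X: x\text{ and }y\text{ lie in the same orbit}\}$ has the relative topology of $X\times X$, and $\tau(x,x\cdot g)=g$. *)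

(* Defs.v *)
From HB Require Import structures.
From mathcomp Require Import all_boot all_order all_fingroup all_algebra.
From mathcomp Require Import generic_quotient.
From mathcomp Require Import all_classical all_reals all_analysis.

Set Implicit Arguments.
Unset Strict Implicit.
Unset Printing Implicit Defensive.

Import Order.TTheory GRing.Theory Num.Theory.
Import numFieldNormedType.Exports.

Local Open Scope classical_set_scope.
Local Open Scope ring_scope.
Local Open Scope quotient_scope.

(* [Ck k U f]: all the iterated partial derivatives of [f] of order at most
   [k] exist and are continuous on [U].  Meaningful for open [U]: the library's
   derivatives at a point of [U] then depend only on the values of [f] on [U]. *)
Fixpoint Ck (R : realType) (n m k : nat) (U : set 'rV[R]_n)
    (f : 'rV[R]_n -> 'rV[R]_m) : Prop :=
  (forall x, U x -> {for x, continuous f}) /\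
  (if k is k'.+1 then
     forall i : 'I_n,
       (forall x, U x -> derivable f x (delta_mx 0 i)) /\
       Ck k' U (fun x => 'D_(delta_mx 0 i) f x)
   else True).

Definition Cinfty (R : realType) (n m : nat) (U : set 'rV[R]_n)
    (f : 'rV[R]_n -> 'rV[R]_m) : Prop := forall k, Ck k U f.

(* A homeomorphism from an open subset of [X] onto an open subset of R^n.
   The values of [chart_map] off [chart_dom] and those of [chart_inv] off
   [chart_map @` chart_dom] are irrelevant. *)
Record chart (R : realType) (n : nat) (X : topologicalType) := Chart {
  chart_dom : set X ;
  chart_map :> X -> 'rV[R]_n ;
  chart_inv : 'rV[R]_n -> X ;
  chart_dom_open : open chart_dom ;
  chart_img_open : open (chart_map @` chart_dom) ;
  chart_mapK : forall x, chart_dom x -> chart_inv (chart_map x) = x ;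
  chart_map_continuous : forall x, chart_dom x -> {for x, continuous chart_map} ;
  chart_inv_continuous : forall y, (chart_map @` chart_dom) y ->
    {for y, continuous chart_inv}
}.

Definition smooth_atlas (R : realType) (n : nat) (X : topologicalType)
    (A : set (chart R n X)) : Prop :=
  (forall x, exists2 phi, A phi & chart_dom phi x) /\
  (forall phi psi, A phi -> A psi ->
     Cinfty (phi @` (chart_dom phi `&` chart_dom psi))
            (psi \o chart_inv phi)).

(* The smooth structure is the maximal atlas generated by [A]. *)
Definition smooth_manifold (R : realType) (n : nat) (X : topologicalType)
    (A : set (chart R n X)) : Prop :=
  [/\ hausdorff_space X, @second_countable X & smooth_atlas A].

(* Smoothness of [f] on the open set [W]. *)
Definition smooth_on (R : realType) (n m : nat) (X Y : topologicalType)
    (A : set (chart R n X)) (B : set (chart R m Y))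
    (W : set X) (f : X -> Y) : Prop :=
  (forall x, W x -> {for x, continuous f}) /\
  (forall phi psi, A phi -> B psi ->
     Cinfty (phi @` (chart_dom phi `&` W `&` f @^-1` chart_dom psi))
            (psi \o f \o chart_inv phi)).

Definition local_diffeomorphism (R : realType) (n m : nat)
    (X Y : topologicalType) (A : set (chart R n X)) (B : set (chart R m Y))
    (f : X -> Y) : Prop :=
  forall x : X, exists W : set X, exists h : Y -> X,
    [/\ open W, W x & open (f @` W)] /\
    [/\ forall w, W w -> h (f w) = w,
        smooth_on A B W f & smooth_on B A (f @` W) h].

Record right_action (G : groupType) (X : Type) := RightAction {
  ract :> X -> G -> X ;
  ract1 : forall x, ract x 1%g = x ;
  ractM : forall x g h, ract x (g * h)%g = ract (ract x g) h
}.

(* As [G] is discrete, [X * G -> X] is smooth iff each translation is. *)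
Definition smooth_action (R : realType) (n : nat) (G : groupType)
    (X : topologicalType) (A : set (chart R n X)) (a : right_action G X) : Prop :=
  forall g : G, smooth_on A A setT (fun x => a x g).

Definition translate (G : groupType) (X : Type) (a : right_action G X)
    (U : set X) (g : G) : set X := (fun x => a x g) @` U.

Definition saturation (G : groupType) (X : Type) (a : right_action G X)
    (U : set X) : set X := \bigcup_g translate a U g.

Definition same_orbit (G : groupType) (X : Type) (a : right_action G X)
    (x y : X) : Prop := exists g, y = a x g.

Definition covering_space_action (G : groupType) (X : topologicalType)
    (a : right_action G X) : Prop :=
  forall x : X, exists2 U : set X, nbhs x U &
    forall g : G, g <> 1%g -> U `&` translate a U g = set0.

Definition discrete_action (G : groupType) (X : topologicalType)
    (a : right_action G X) : Prop :=
  covering_space_action a /\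
  (forall x y : X, ~ same_orbit a x y ->
     exists U V : set X,
       [/\ nbhs x U, nbhs y V & saturation a U `&` saturation a V = set0]).

Section OrbitSpace.
Context (G : groupType) (X : topologicalType) (a : right_action G X).

Definition orbit_rel (x y : X) : bool := `[< same_orbit a x y >].

Lemma orbit_rel_refl : reflexive orbit_rel.
Proof. by move=> x; apply/asboolP; exists 1%g; rewrite ract1. Qed.

Lemma orbit_rel_sym : symmetric orbit_rel.
Proof.
by move=> x y; apply/asboolP/asboolP => -[g ->]; exists g^-1%g;
  rewrite -ractM mulgV ract1.
Qed.

Lemma orbit_rel_trans : transitive orbit_rel.
Proof.
move=> y x z /asboolP[g ->] /asboolP[h ->]; apply/asboolP.
by exists (g * h)%g; rewrite ractM.
Qed.

Definition orbit_equiv : equiv_rel X :=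
  EquivRel orbit_rel orbit_rel_refl orbit_rel_sym orbit_rel_trans.

Definition orbit_space : topologicalType :=
  quotient_topology {eq_quot orbit_equiv}.

Definition orbit_proj (x : X) : orbit_space :=
  \pi_(quotient_topology {eq_quot orbit_equiv}) x.

Definition orbit_pairs : set (X * X) := [set p | same_orbit a p.1 p.2].

(* [orbit_pairs], seen as a type, carries the topology induced by [X * X]. *)
Definition translation_map (p : set_type orbit_pairs) : discrete_topology G :=
  projT1 (cid (set_valP p)).

Lemma translation_mapE : covering_space_action a ->
  forall (x : X) (g : G) (p : set_type orbit_pairs),
    set_val p = (x, a x g) -> translation_map p = g.
Proof.
move=> acov x g p px; rewrite /translation_map; case: cid => h /=.
rewrite -set_valE px /= => gh; apply/eqP; rewrite eq_sym -(inj_eq (mulIg h^-1)%g) mulgV.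
apply/negPn/negP => /eqP gh1; have [U Ux /(_ _ gh1)] := acov x.
move=> /seteqP[/(_ x) + _]; apply; split; first exact: nbhs_singleton.
exists x; first exact: nbhs_singleton.
by rewrite ractM gh -ractM mulgV ract1.
Qed.

End OrbitSpace.

(* Main.v *)
Require Import Defs.
From HB Require Import structures.
From mathcomp Require Import all_boot all_order all_fingroup all_algebra.
From mathcomp Require Import generic_quotient.
From mathcomp Require Import all_classical all_reals all_analysis.
Import numFieldNormedType.Exports.
Local Open Scope classical_set_scope.
Local Open Scope ring_scope.

(* Call an open W in X a slice if W meets none of its translates Wg, g <> 1.
   The projection X -> X/G is open and injective on a slice W, so it has a
   continuous section over the image of W, and composing this section with the
   charts of X gives charts of X/G.  Near any point the composite of the
   projection with such a section is a single translation, so every coordinate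
   change is locally one expressing a translation of X, hence is smooth.
   Separation of orbits gives Hausdorffness, and tau is constant on the pairs
   of X x_G X near (x, xg), namely those in W x Wg for a slice W at x. *)

(** * Locality of continuity and of the classes C^k *)

Lemma near_eq_continuous {T U : topologicalType} (f g : T -> U) (x : T) :
  (\forall z \near x, f z = g z) ->
  {for x, continuous g} -> {for x, continuous f}.
Proof.
move=> fg; rewrite /prop_for /continuous_at (nbhs_singleton fg).
apply: cvg_trans; apply: near_eq_cvg.
by apply: filterS fg => z.
Qed.

Section Ck.
Context {R : realType} {n m : nat}.
Implicit Types (U V : set 'rV[R]_n) (f g : 'rV[R]_n -> 'rV[R]_m).

Lemma Ck_sub k U V f : V `<=` U -> Ck k U f -> Ck k V f.
Proof.
move=> VU; elim: k f => [|k IHk] f /= [fc fd]; split => //.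
- by move=> x /VU; exact: fc.
- by move=> x /VU; exact: fc.
- move=> i; have [fdi Cfi] := fd i; split; last exact: IHk.
  by move=> x /VU; exact: fdi.
Qed.

(** A derivative at a point depends only on the germ there. Since [V] and [g] vary with [x], [f] may
    agree with different translations near different points. *)
Lemma Ck_local k U f :
  (forall x, U x -> exists V g,
     [/\ open V, V x, forall z, V z -> f z = g z & Ck k V g]) -> Ck k U f.
Proof.
have nearV V g h x : open V -> V x -> (forall z, V z -> h z = g z) ->
    \forall z \near x, h z = g z.
  move=> oV Vx hg; apply: filterS hg _.
  exact: open_nbhs_nbhs.
elim: k U f => [|k IHk] U f loc; split => //.
- move=> x /loc[V [g [oV Vx fg [gc _]]]].
  by apply: (near_eq_continuous _ g); [exact: nearV fg|exact: gc].
- move=> x /loc[V [g [oV Vx fg [gc _]]]].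
  by apply: (near_eq_continuous _ g); [exact: nearV fg|exact: gc].
- move=> i; split.
  + move=> x /loc[V [g [oV Vx fg [_ /(_ i)[gd _]]]]].
    apply: near_eq_derivable (gd _ Vx).
    by apply: nearV oV Vx _ => z Vz /=; rewrite fg.
  (* The same [V] serves for the partial derivative, with that of [g] as local model. *)
  + apply: IHk => x /loc[V [g [oV Vx fg [_ /(_ i)[_ Cg]]]]].
    exists V, (fun z => 'D_(delta_mx 0 i) g z); split => // z Vz.
    by apply: near_eq_derive; exact: nearV fg.
Qed.

End Ck.

Lemma chart_image_open {R : realType} {n : nat} {X : topologicalType}
    (phi : chart R n X) (W : set X) :
  open W -> W `<=` chart_dom phi -> open (phi @` W).
Proof.
move=> oW Wphi; rewrite openE => _ [w Ww <-].
have phiw : (phi @` chart_dom phi) (phi w) by exists w => //; exact: Wphi.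
have imgN : nbhs (phi w) (phi @` chart_dom phi).
  by apply: open_nbhs_nbhs; split => //; exact: chart_img_open.
have invN : nbhs (phi w) (chart_inv phi @^-1` W).
  apply: (chart_inv_continuous phiw); rewrite chart_mapK; last exact: Wphi.
  exact: open_nbhs_nbhs.
apply: filterS2 imgN invN => _ [z domz <-] /=.
by rewrite chart_mapK// => Wz; exists z.
Qed.

(** * Maps that are locally translations *)

Section SmoothAction.
Context {R : realType} {n : nat} {X : topologicalType}.
Context {A : set (chart R n X)} {G : groupType} {a : right_action G X}.
Hypothesis smooth_a : smooth_action A a.

Lemma smooth_action_continuous (g : G) : continuous (fun x => a x g).
Proof. by move=> x; apply: (smooth_a g).1. Qed.

Lemma Cinfty_near_translation (phi psi : chart R n X) (S : set X) (f : X -> X) :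
  A phi -> A psi -> S `<=` chart_dom phi -> S `<=` f @^-1` chart_dom psi ->
  (forall x, S x -> exists g, \forall z \near x, f z = a z g) ->
  Cinfty (phi @` S) (psi \o f \o chart_inv phi).
Proof.
move=> Aphi Apsi Sphi Spsi fa k; apply: Ck_local => _ [x Sx <-].
have [g fag] := fa x Sx.
have : nbhs x [set z | f z = a z g] by exact: fag.
rewrite nbhsE => -[N [oN Nx] fN].
(* This is the set on whose image [smooth_a g] gives smoothness in the charts [phi] and [psi]. *)
pose D := chart_dom phi `&` setT `&` (fun z => a z g) @^-1` chart_dom psi.
have oD : open D.
  apply: openI; first by rewrite setIT; exact: chart_dom_open.
  apply: open_comp; last exact: chart_dom_open.
  by move=> z _; exact: smooth_action_continuous.
exists (phi @` (N `&` D)), (psi \o (fun z => a z g) \o chart_inv phi); split.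
- by apply: chart_image_open; [exact: openI|move=> z [_ [[]]]].
- exists x => //; split => //; split; first by split => //; exact: Sphi.
  by rewrite /= -fN//; exact: Spsi.
- by move=> _ [z [Nz [[domz _] _]] <-] /=; rewrite chart_mapK// fN.
- apply: Ck_sub; last exact: ((smooth_a g).2 phi psi Aphi Apsi k).
  by move=> _ [z [_ Dz] <-]; exists z.
Qed.

End SmoothAction.

(** * Topology of the orbit space, slices and their sections *)

Section OrbitProjection.
Context {G : groupType} {X : topologicalType} {a : right_action G X}.

Lemma orbit_projP (x y : X) :
  orbit_proj a x = orbit_proj a y <-> same_orbit a x y.
Proof.
split; first by move=> /eqquotP /asboolP.
by move=> xy; apply/eqquotP/asboolP.
Qed.

Lemma orbit_proj_repr (y : orbit_space a) : orbit_proj a (repr y) = y.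
Proof. exact: reprK. Qed.

Lemma orbit_proj_continuous : continuous (orbit_proj a).
Proof. exact: pi_continuous. Qed.

Lemma orbit_proj_ract (x : X) (g : G) : orbit_proj a (a x g) = orbit_proj a x.
Proof. by apply/esym/orbit_projP; exists g. Qed.

Lemma ract_inv (x : X) (g : G) : a (a x g) g^-1%g = x.
Proof. by rewrite -ractM mulgV ract1. Qed.

Hypothesis ract_continuous : forall g, continuous (fun x => a x g).

(** The saturation of [U] is written as a union of preimages of [U] under translations, so
    continuity of each translation makes it open. *)
Lemma orbit_proj_open (U : set X) : open U -> open (orbit_proj a @` U).
Proof.
move=> oU.
have satU : orbit_proj a @^-1` (orbit_proj a @` U)
    = \bigcup_g (fun x => a x g) @^-1` U.
  apply/seteqP; split => x.
    by move=> [u Uu /esym/orbit_projP[g ug]]; exists g => //=; rewrite -ug.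
  by move=> [g _ Ug]; exists (a x g) => //; exact: orbit_proj_ract.
suff : open (orbit_proj a @^-1` (orbit_proj a @` U)) by [].
rewrite satU; apply: bigcup_open => g _.
by apply: open_comp => // x _; exact: ract_continuous.
Qed.

Lemma orbit_proj_nbhs (x : X) (U : set X) :
  nbhs x U -> nbhs (orbit_proj a x) (orbit_proj a @` U).
Proof.
rewrite nbhsE => -[V [oV Vx] VU].
apply: filterS (open_nbhs_nbhs _); first exact: image_subset VU.
by split; [exact: orbit_proj_open|exists x].
Qed.

Lemma orbit_space_hausdorff : discrete_action a ->
  hausdorff_space (orbit_space a).
Proof.
move=> [_ sep] p q; rewrite -(orbit_proj_repr p) -(orbit_proj_repr q) => clpq.
(* Hausdorffness is phrased by cluster points: the images of [U] and [V] must meet, which puts some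
   [u] in both saturations. *)
apply/orbit_projP; apply: contrapT => /sep[U [V [Ux Vy UV]]].
have [_ [[u Uu <-] [v Vv /orbit_projP[g ug]]]] :=
  clpq _ _ (orbit_proj_nbhs _ _ Ux) (orbit_proj_nbhs _ _ Vy).
have : (saturation a U `&` saturation a V) u.
  by split; [exists 1%g => //; exists u; rewrite ?ract1|exists g => //; exists v].
by rewrite UV.
Qed.

(** A continuous open surjection carries a base to a base: pull a neighborhood back, pick a base set
    inside, push it forward. *)
Lemma orbit_space_second_countable :
  @second_countable X -> @second_countable (orbit_space a).
Proof.
move=> [D cD [oD baseD]]; exists [set orbit_proj a @` U | U in D].
  exact: card_le_trans (card_image_le _ _) cD.
split; first by move=> _ [U DU <-]; apply: orbit_proj_open; exact: oD.
move=> y N; rewrite -(orbit_proj_repr y) => /orbit_proj_continuous.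
move=> /baseD[U [DU Uy] UN].
exists (orbit_proj a @` U); first by split; [exists U|exists (repr y)].
by move=> _ [u /UN Nu <-].
Qed.

Definition slice (W : set X) : Prop :=
  open W /\ forall w g, W w -> W (a w g) -> g = 1%g.

Lemma covering_slice (x : X) (U : set X) :
  covering_space_action a -> nbhs x U ->
  exists W, [/\ slice W, W x & W `<=` U].
Proof.
(* [V] need not be open, hence the interior; disjointness from translates passes to subsets. *)
move=> /(_ x)[V Vx disj] Ux; exists (V `&` U)^°.
split; [split|exact: filterI|]; first exact: open_interior.
- move=> w g /interior_subset[Vw _] /interior_subset[Vwg _].
  apply: contrapT => /disj; apply/eqP/set0P; exists (a w g).
  by split => //; exists w.
- by move=> z /interior_subset[].
Qed.

(** The default [repr y] makes this a right inverse of the projection even off the image of [W]. *)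
Definition slice_section (W : set X) (y : orbit_space a) : X :=
  xget (repr y) [set w | W w /\ orbit_proj a w = y].

Lemma orbit_proj_section (W : set X) (y : orbit_space a) :
  orbit_proj a (slice_section W y) = y.
Proof.
by rewrite /slice_section; case: xgetP => [_ _ []|_] //; exact: orbit_proj_repr.
Qed.

Lemma slice_section_mem (W : set X) (y : orbit_space a) :
  (orbit_proj a @` W) y -> W (slice_section W y).
Proof.
move=> [w Ww wy]; rewrite /slice_section.
by case: xgetP => [_ _ []//|/(_ w)[]].
Qed.

Lemma slice_sectionK (W : set X) : slice W ->
  {in W, cancel (orbit_proj a) (slice_section W)}.
Proof.
move=> [_ sW] w /set_mem Ww; apply: xget_unique => // z [Wz].
by move=> /esym/orbit_projP[g zg]; rewrite zg (sW w g) -?zg ?ract1.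
Qed.

(** The preimage of [N] contains the image of [N] intersected with [W], a neighborhood because the
    projection is open. *)
Lemma slice_section_continuous (W : set X) (y : orbit_space a) :
  slice W -> (orbit_proj a @` W) y -> {for y, continuous (slice_section W)}.
Proof.
move=> sW [w Ww <-] N; rewrite slice_sectionK ?inE// => Nw.
have /orbit_proj_nbhs : nbhs w (N `&` W).
  by apply: filterI => //; apply: open_nbhs_nbhs; split => //; exact: sW.1.
apply: filterS => _ [z [Nz Wz] <-] /=.
by rewrite /= slice_sectionK ?inE.
Qed.

(* The translation carrying x into W also carries the points near x into W. *)
Lemma slice_section_near (W : set X) (x : X) :
  slice W -> (orbit_proj a @` W) (orbit_proj a x) ->
  exists g, \forall z \near x, slice_section W (orbit_proj a z) = a z g.
Proof.
move=> sW [w Ww /esym/orbit_projP[g wg]]; exists g.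
have Wxg : nbhs (a x g) W.
  by rewrite -wg; apply: open_nbhs_nbhs; split => //; exact: sW.1.
have Wx : nbhs x [set z | W (a z g)] := ract_continuous g x W Wxg.
apply: filterS Wx => z Wz.
by rewrite -(orbit_proj_ract z g) slice_sectionK ?inE.
Qed.

(** * Charts of the orbit space *)

Section OrbitChart.
Context {R : realType} {n : nat} (phi : chart R n X) (W : set X).
Hypotheses (sW : slice W) (Wphi : W `<=` chart_dom phi).

Let dom : set (orbit_space a) := orbit_proj a @` W.
Let map (y : orbit_space a) : 'rV[R]_n := phi (slice_section W y).
Let inv (v : 'rV[R]_n) : orbit_space a := orbit_proj a (chart_inv phi v).

Let map_image : map @` dom = phi @` W.
Proof.
rewrite /map /dom image_comp; apply: eq_imagel => w Ww /=.
by rewrite slice_sectionK ?inE.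
Qed.

Let dom_open : open dom.
Proof. by apply: orbit_proj_open; exact: sW.1. Qed.

Let img_open : open (map @` dom).
Proof. by rewrite map_image; apply: chart_image_open => //; exact: sW.1. Qed.

Let mapK y : dom y -> inv (map y) = y.
Proof.
move=> [w Ww <-]; rewrite /map /inv slice_sectionK ?inE//.
by rewrite chart_mapK//; exact: Wphi.
Qed.

Let map_continuous y : dom y -> {for y, continuous map}.
Proof.
move=> domy; apply: continuous_comp; first exact: slice_section_continuous.
case: domy => w Ww <-; rewrite slice_sectionK ?inE//.
by apply: chart_map_continuous; exact: Wphi.
Qed.

Let inv_continuous v : (map @` dom) v -> {for v, continuous inv}.
Proof.
rewrite map_image => -[w Ww <-].
apply: continuous_comp; last exact: orbit_proj_continuous.
by apply: chart_inv_continuous; exists w => //; exact: Wphi.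
Qed.

Definition orbit_chart : chart R n (orbit_space a) :=
  Chart dom_open img_open mapK map_continuous inv_continuous.

End OrbitChart.

End OrbitProjection.

(** * Continuity of the translation map *)

Lemma translation_map_continuous {G : groupType} {X : topologicalType}
    (a : right_action G X) :
  (forall g, continuous (fun x => a x g)) ->
  covering_space_action a -> continuous (@translation_map G X a).
Proof.
move=> ract_continuous acov p; apply/discrete_cvg; first exact/fmap_filter/nbhs_filter.
have trE (q : set_type (orbit_pairs a)) :
    (val q).2 = a (val q).1 (translation_map q).
  exact: projT2 (cid (set_valP q)).
set g := translation_map p.
have [W [[oW sW] Wx _]] := covering_slice _ _ acov (filterT (F := nbhs (val p).1)).
have nW : nbhs (val p).1 W by exact: open_nbhs_nbhs.
have fst_cts :
    {for p, continuous (fun q : set_type (orbit_pairs a) => (val q).1)}.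
  apply: continuous_comp; first exact: initial_continuous.
  exact: cvg_fst.
have snd_cts :
    {for p, continuous (fun q : set_type (orbit_pairs a) => (val q).2)}.
  apply: continuous_comp; first exact: initial_continuous.
  exact: cvg_snd.
have near1 : nbhs p [set q | W (val q).1] := fst_cts W nW.
(* For a nearby pair (y, yh), both y and y(hg^-1) lie in [W], so hg^-1 = 1. *)
have near2 : nbhs p [set q | W (a (val q).2 g^-1%g)].
  apply: (continuous_comp snd_cts (ract_continuous _ _)).
  suff : nbhs (a (val p).2 g^-1%g) W by [].
  by rewrite trE ract_inv.
apply: (@filterS2 _ _ (nbhs_filter p) _ _ _ _ near1 near2) => q Wq; rewrite /= trE -ractM => Wqg.
by rewrite /= -[LHS](mulgKV (g : G)) (sW _ _ Wq Wqg) mul1g.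
Qed.

(** * The smooth structure on the orbit space *)

Section OrbitAtlas.
Context {R : realType} {n : nat} {X : topologicalType}.
Context {A : set (chart R n X)} {G : groupType} {a : right_action G X}.
Hypothesis smooth_a : smooth_action A a.

Let ract_continuous := smooth_action_continuous smooth_a.

Definition orbit_atlas : set (chart R n (orbit_space a)) :=
  [set c | exists phi W (sW : slice W) (Wphi : W `<=` chart_dom phi),
     A phi /\ c = orbit_chart ract_continuous phi W sW Wphi].

(** Coordinate changes, and the projection and its local sections read in charts, all unfold to this
    composite, which is locally a translation. *)
Lemma Cinfty_slice_section (phi psi : chart R n X) (W S : set X) :
  A phi -> A psi -> slice (a := a) W -> S `<=` chart_dom phi ->
  S `<=` orbit_proj a @^-1` (orbit_proj a @` W) ->
  S `<=` (slice_section W \o orbit_proj a) @^-1` chart_dom psi ->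
  Cinfty (phi @` S) (psi \o (slice_section W \o orbit_proj a) \o chart_inv phi).
Proof.
move=> Aphi Apsi sW Sphi SW Spsi.
apply: (Cinfty_near_translation smooth_a) => // x /SW.
exact: slice_section_near.
Qed.

(** Rewrites a domain coming from the orbit space as one coming from [X]; the inclusion suffices, as
    [Ck] restricts to subsets. *)
Lemma orbit_chart_image (phi : chart R n X) (W : set X)
    (T : set (orbit_space a)) :
  T `<=` orbit_proj a @` W ->
  [set phi (slice_section W y) | y in T]
    `<=` phi @` (W `&` orbit_proj a @^-1` T).
Proof.
move=> TW _ [y Ty <-]; exists (slice_section W y) => //.
split; first by apply: slice_section_mem; exact: TW.
by rewrite /= orbit_proj_section.
Qed.

Lemma orbit_atlas_smooth : smooth_atlas A -> covering_space_action a ->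
  smooth_atlas orbit_atlas.
Proof.
move=> [cover _] acov; split.
  move=> y; have [phi Aphi phiy] := cover (repr y).
  have [|W [sW Wy Wphi]] := covering_slice (repr y) (chart_dom phi) acov.
    by apply: open_nbhs_nbhs; split => //; exact: chart_dom_open.
  exists (orbit_chart ract_continuous phi W sW Wphi).
    by exists phi, W, sW, Wphi.
  by exists (repr y) => //; exact: orbit_proj_repr.
move=> _ _ [phi [W [sW [Wphi [Aphi ->]]]]] [psi [V [sV [Vpsi [Apsi ->]]]]] k /=.
apply: Ck_sub; first by apply: orbit_chart_image => y [].
apply: (Cinfty_slice_section phi psi V) => //.
- by move=> x [/Wphi].
- by move=> x [_ []].
- by move=> x [_ [_ /slice_section_mem/Vpsi]].
Qed.

Lemma orbit_proj_local_diffeomorphism :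
  covering_space_action a ->
  local_diffeomorphism A orbit_atlas (orbit_proj a).
Proof.
move=> acov x.
have [W [sW Wx _]] := covering_slice x setT acov filterT.
(* The local inverse over the image of [W] is its section. *)
exists W, (slice_section W); split; split=> //.
- exact: sW.1.
- by apply: orbit_proj_open => //; exact: sW.1.
- by move=> w Ww; rewrite slice_sectionK ?inE.
- split; first by move=> w _; exact: orbit_proj_continuous.
  move=> phi _ Aphi [psi [V [sV [Vpsi [Apsi ->]]]]] /=.
  apply: (Cinfty_slice_section phi psi V) => //.
  + by move=> z [[]].
  + by move=> z [_ /slice_section_mem/Vpsi].
- split; first by move=> y; exact: slice_section_continuous.
  move=> _ psi [phi [V [sV [Vphi [Aphi ->]]]]] Apsi k /=.
  apply: Ck_sub; first by apply: orbit_chart_image => y [[]].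
  apply: (Cinfty_slice_section phi psi W) => //.
  + by move=> z [/Vphi].
  + by move=> z [_ [[]]].
  + by move=> z [_ []].
Qed.

End OrbitAtlas.

Theorem corollary4p10 (R : realType) (n : nat) (X : topologicalType)
    (A : set (chart R n X)) (G : groupType) (a : right_action G X)
    (manX : smooth_manifold A)
    (smooth_a : smooth_action A a)
    (discrete_a : discrete_action a) :
  (exists B : set (chart R n (orbit_space a)),
     smooth_manifold B /\ local_diffeomorphism A B (@orbit_proj G X a)) /\
  continuous (@translation_map G X a).
Proof.
have [T2X cX atlasA] := manX; have [acov _] := discrete_a.
have ract_continuous := smooth_action_continuous smooth_a.
split; last exact: translation_map_continuous.
exists (orbit_atlas smooth_a); split; first split.
- exact: orbit_space_hausdorff.
- exact: orbit_space_second_countable.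
- exact: orbit_atlas_smooth.
- exact: orbit_proj_local_diffeomorphism.
Qed.
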